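(* Let $\mathscr{S}$ be a fake pullback ready bicategory. Fake pullbacks in $\mathscr{S}$ stack: let $X\xrightarrow{t}U\xrightarrow{r}W$ and $s:V\to W$ be morphisms of $\mathscr{S}$. If $U\xleftarrow{\bar s}Q\xrightarrow{\bar r}V$ is a fake pullback of $U\xrightarrow{r}W\xleftarrow{s}V$, and $X\xleftarrow{\bar{\bar s}}P\xrightarrow{\bar t}Q$ is a fake pullback of $X\xrightarrow{t}U\xleftarrow{\bar s}Q$, then $X\xleftarrow{\bar{\bar s}}P\xrightarrow{\bar r\circ\bar t}V$ is a fake pullback of $X\xrightarrow{r\circ t}W\xleftarrow{s}V$.
   Context: A bicategory is locally preordered when every hom-category is a preorder (at most one 2-cell between parallel morphisms). Factorization system $(\mathscr{U},\mathscr{L})$ on a bicategory $\mathscr{S}$: classes of morphisms containing the equivalences, closed under composition and under invertible 2-cells, such that (FS1) for all $e:X\to Y$ in $\mathscr{U}$ and $m:A\to B$ in $\mathscr{L}$, the square of functors (commuting up to the associativity isomorphism) with vertices $\mathscr{S}(Y,A),\mathscr{S}(X,A),\mathscr{S}(Y,B),\mathscr{S}(X,B)$, given by precomposition with $e$ and postcomposition with $m$, is a bipullback; (FS2) every morphism $f$ satisfies $f\cong m\circ e$ for some $e\in\mathscr{U}$, $m\in\mathscr{L}$. A bicategory $\mathscr{S}$ is fake pullback ready when it is locally preordered and equipped with a factorization system $(\mathscr{U},\mathscr{L})$ satisfying: V1. Bipullbacks of morphisms in $\mathscr{U}$ along morphisms in $\mathscr{U}$ exist and have projections in $\mathscr{U}$;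 bipullbacks of morphisms in $\mathscr{L}$ along morphisms in $\mathscr{L}$ exist and have projections in $\mathscr{L}$. V2. Given $X\xrightarrow{a}Z\xleftarrow{x}Y$ with $a\in\mathscr{U}$, $x\in\mathscr{L}$, there exist $b:U\to Y$ in $\mathscr{U}$, $y:U\to X$ in $\mathscr{L}$ and a 2-cell $x\circ b\Rightarrow a\circ y$; this square is unique up to equivalence (any two choices of $(U,b,y)$ are related by an equivalence of the objects $U$ compatible with $b$ and $y$ up to invertible 2-cells). V3. Given $x:X\to Y$, $y:A\to B$, $r:X\to A$, $s:Y\to B$, $t:Z\to C$ in $\mathscr{L}$ and $a:Y\to Z$, $b:B\to C$ in $\mathscr{U}$, such that $s\circ x\cong y\circ r$ is a bipullback square (of $s$ and $y$) and there is a 2-cell $t\circ a\Rightarrow b\circ s$; and given factorizations $a\circ x\cong v\circ c$ (through $I$) and $b\circ y\cong w\circ d$ (through $J$) with $c:X\to I$, $d:A\to J$ in $\mathscr{U}$ and $v:I\to Z$, $w:J\to C$ in $\mathscr{L}$; there exists $q:I\to J$ in $\mathscr{L}$ with a 2-cell $q\circ c\Rightarrow d\circ r$ and with $t\circ v\cong w\circ q$ a bipullback square (of $t$ and $w$). V4. Given $x:X\to Y$, $u:D\to E$ in $\mathscr{L}$ and $h:E\to F$, $a:Y\to Z$, $e:D\to X$, $f:E\to Y$, $g:F\to Z$ in $\mathscr{U}$, such that there is a 2-cell $x\circ e\Rightarrow f\circ u$ and $g\circ h\cong a\circ f$ is a bipullback square (of $g$ and $a$); and given factorizations $h\circ u\cong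 p\circ k$ (through $K$) and $a\circ x\cong v\circ c$ (through $I$) with $k:D\to K$, $c:X\to I$ in $\mathscr{U}$ and $p:K\to F$, $v:I\to Z$ in $\mathscr{L}$; there exists $j:K\to I$ in $\mathscr{U}$ with $j\circ k\cong c\circ e$ a bipullback square (of $j$ and $c$) and a 2-cell $v\circ j\Rightarrow g\circ p$. Fake pullback of a cospan $U\xrightarrow{r}W\xleftarrow{s}V$ in a fake pullback ready $\mathscr{S}$: factorize $r\cong x\circ a$ with $a:U\to R$ in $\mathscr{U}$, $x:R\to W$ in $\mathscr{L}$, and $s\cong y\circ b$ with $b:V\to S$ in $\mathscr{U}$, $y:S\to W$ in $\mathscr{L}$. Take the bipullback $R\xleftarrow{y'}Z\xrightarrow{x'}S$ of $x$ and $y$ (V1). By V2 choose $\bar a:X\to Z$ in $\mathscr{U}$ and $\bar y:X\to U$ in $\mathscr{L}$ with a 2-cell $y'\circ\bar a\Rightarrow a\circ\bar y$, and $\bar b:Y\to Z$ in $\mathscr{U}$ and $\bar x:Y\to V$ in $\mathscr{L}$ with a 2-cell $x'\circ\bar b\Rightarrow b\circ\bar x$. Take the bipullback $X\xleftarrow{b'}Q\xrightarrow{a'}Y$ of $\bar a$ and $\bar b$ (V1). The span $U\xleftarrow{\bar y\circ b'}Q\xrightarrow{\bar x\circ a'}V$ is the fake pullback; it is determined up to isomorphism of spans, and any span isomorphic to it is called a fake pullback. Here spans $X\xleftarrow{p}S\xrightarrow{q}Y$ and $X\xleftarrow{p'}S'\xrightarrow{q'}Y$ are isomorphic when there is an equivalence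 $h:S\to S'$ with $p'\circ h\cong p$ and $q'\circ h\cong q$. *)

(* Defs.v *)
Declare Scope bicat_scope.
Delimit Scope bicat_scope with bicat.
Open Scope bicat_scope.

Reserved Notation "a ⇒ b" (at level 70, no associativity).
Reserved Notation "a ≅ b" (at level 70, no associativity).
Reserved Notation "β · α" (at level 40, left associativity).
Reserved Notation "g ∘ f" (at level 40, left associativity).
Reserved Notation "β ⋆ α" (at level 38, left associativity).
Reserved Notation "f ∈ K" (at level 70, no associativity).

Record Category : Type := {
  obj :> Type;
  arr : obj -> obj -> Type;
  idt : forall a, arr a a;
  cmp : forall {a b c}, arr b c -> arr a b -> arr a c;
  cmp_idl : forall a b (α : arr a b), cmp (idt b) α = α;
  cmp_idr : forall a b (α : arr a b), cmp α (idt a) = α;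
  cmp_assoc : forall a b c d (γ : arr c d) (β : arr b c) (α : arr a b),
    cmp γ (cmp β α) = cmp (cmp γ β) α
}.

Arguments arr {_} _ _.
Arguments idt {_} _.
Arguments cmp {_ _ _ _} _ _.

Notation "a ⇒ b" := (arr a b) : bicat_scope.
Notation "β · α" := (cmp β α) : bicat_scope.

Record Iso {C : Category} (a b : C) : Type := {
  fwd :> a ⇒ b;
  bwd : b ⇒ a;
  bwd_fwd : bwd · fwd = idt a;
  fwd_bwd : fwd · bwd = idt b
}.

Arguments fwd {_ _ _} _.
Arguments bwd {_ _ _} _.
Arguments bwd_fwd {_ _ _} _.
Arguments fwd_bwd {_ _ _} _.

Notation "a ≅ b" := (inhabited (Iso a b)) : bicat_scope.

Definition iso_sym {C : Category} {a b : C} (φ : Iso a b) : Iso b a :=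
  {| fwd := bwd φ; bwd := fwd φ; bwd_fwd := fwd_bwd φ; fwd_bwd := bwd_fwd φ |}.

Lemma cmp_cancel {C : Category} {a c d e : C} (δ : d ⇒ e) (γ : c ⇒ d)
    (β : d ⇒ c) (α : a ⇒ d) :
  γ · β = idt d -> (δ · γ) · (β · α) = δ · α.
Proof.
  intro H.
  now rewrite <- cmp_assoc, (cmp_assoc _ _ _ _ _ γ β α), H, cmp_idl.
Qed.

Definition iso_trans {C : Category} {a b c : C} (φ : Iso a b) (ψ : Iso b c) :
  Iso a c.
Proof.
  refine {| fwd := ψ · φ; bwd := bwd φ · bwd ψ |}.
  - exact (eq_trans (cmp_cancel _ _ _ _ (bwd_fwd ψ)) (bwd_fwd φ)).
  - exact (eq_trans (cmp_cancel _ _ _ _ (fwd_bwd φ)) (fwd_bwd ψ)).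
Defined.

Record Functor (C D : Category) : Type := {
  fobj :> C -> D;
  fmap : forall {a b : C}, a ⇒ b -> fobj a ⇒ fobj b;
  fmap_idt : forall a, fmap (idt a) = idt (fobj a);
  fmap_cmp : forall a b c (β : b ⇒ c) (α : a ⇒ b),
    fmap (β · α) = fmap β · fmap α
}.

Arguments fobj {_ _} _ _.
Arguments fmap {_ _} _ {_ _} _.
Arguments fmap_idt {_ _} _ _.
Arguments fmap_cmp {_ _} _ {_ _ _} _ _.

Definition functor_comp {C D E : Category} (G : Functor D E) (F : Functor C D) :
  Functor C E.
Proof.
  refine {| fobj := fun a => G (F a);
            fmap := fun a b α => fmap G (fmap F α) |}.
  - intro a. now rewrite !fmap_idt.
  - intros a b c β α. now rewrite !fmap_cmp.
Defined.

Record NatIso {C D : Category} (F G : Functor C D) : Type := {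
  component :> forall a, Iso (F a) (G a);
  naturality : forall a b (α : a ⇒ b),
    component b · fmap F α = fmap G α · component a
}.

Arguments component {_ _ _ _} _ _.
Arguments naturality {_ _ _ _} _ {_ _} _.

(** A square of functors commuting up to a natural isomorphism [θ] is a
    bipullback when the comparison functor from [P] to the iso-comma category
    of [F] and [G] is an equivalence.  An object of that category is a triple
    [(a, b, φ : F a ≅ G b)], a morphism a pair of morphisms compatible with the
    two isomorphisms; the two clauses say that the comparison functor
    [z ↦ (H z, K z, θ z)] is essentially surjective and fully faithful. *)

Definition is_bipullback_cat {P A B C : Category}
    {H : Functor P A} {K : Functor P B} {F : Functor A C} {G : Functor B C}
    (θ : NatIso (functor_comp F H) (functor_comp G K)) : Prop :=
  (forall (a : A) (b : B) (φ : Iso (F a) (G b)),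
     exists (z : P) (α : Iso (H z) a) (β : Iso (K z) b),
       φ · fmap F α = fmap G β · θ z) /\
  (forall (z z' : P) (α : H z ⇒ H z') (β : K z ⇒ K z'),
     θ z' · fmap F α = fmap G β · θ z ->
     exists! γ : z ⇒ z', fmap H γ = α /\ fmap K γ = β).

(** [g ∘ f] is "[g] after [f]"; [β · α] is vertical and [β ⋆ α] horizontal
    composition of 2-cells. *)

Record Bicategory : Type := {
  ob :> Type;
  hom : ob -> ob -> Category;
  id1 : forall X, hom X X;
  comp : forall {X Y Z}, hom Y Z -> hom X Y -> hom X Z
    where "g ∘ f" := (comp g f);
  hcomp : forall {X Y Z} {g g' : hom Y Z} {f f' : hom X Y},
    g ⇒ g' -> f ⇒ f' -> g ∘ f ⇒ g' ∘ f'
    where "β ⋆ α" := (hcomp β α);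
  hcomp_idt : forall {X Y Z} (g : hom Y Z) (f : hom X Y),
    idt g ⋆ idt f = idt (g ∘ f);
  interchange : forall {X Y Z} {g g' g'' : hom Y Z} {f f' f'' : hom X Y}
      (β' : g' ⇒ g'') (β : g ⇒ g') (α' : f' ⇒ f'') (α : f ⇒ f'),
    (β' · β) ⋆ (α' · α) = (β' ⋆ α') · (β ⋆ α);
  assoc : forall {X Y Z T} (h : hom Z T) (g : hom Y Z) (f : hom X Y),
    Iso (h ∘ (g ∘ f)) ((h ∘ g) ∘ f);
  assoc_nat : forall {X Y Z T} {h h' : hom Z T} {g g' : hom Y Z}
      {f f' : hom X Y} (γ : h ⇒ h') (β : g ⇒ g') (α : f ⇒ f'),
    assoc h' g' f' · (γ ⋆ (β ⋆ α)) = ((γ ⋆ β) ⋆ α) · assoc h g f;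
  lunit : forall {X Y} (f : hom X Y), Iso (id1 Y ∘ f) f;
  lunit_nat : forall {X Y} {f f' : hom X Y} (α : f ⇒ f'),
    lunit f' · (idt (id1 Y) ⋆ α) = α · lunit f;
  runit : forall {X Y} (f : hom X Y), Iso (f ∘ id1 X) f;
  runit_nat : forall {X Y} {f f' : hom X Y} (α : f ⇒ f'),
    runit f' · (α ⋆ idt (id1 X)) = α · runit f;
  pentagon : forall {X Y Z T V}
      (k : hom T V) (h : hom Z T) (g : hom Y Z) (f : hom X Y),
    assoc (k ∘ h) g f · assoc k h (g ∘ f)
    = (assoc k h g ⋆ idt f) · assoc k (h ∘ g) f · (idt k ⋆ assoc h g f);
  triangle : forall {X Y Z} (g : hom Y Z) (f : hom X Y),
    (runit g ⋆ idt f) · assoc g (id1 Y) f = idt g ⋆ lunit f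
}.

Arguments hom {_} _ _.
Arguments id1 {_} _.
Arguments comp {_ _ _ _} _ _.
Arguments hcomp {_ _ _ _ _ _ _ _} _ _.
Arguments hcomp_idt {_ _ _ _} _ _.
Arguments interchange {_ _ _ _ _ _ _ _ _ _} _ _ _ _.
Arguments assoc {_ _ _ _ _} _ _ _.
Arguments assoc_nat {_ _ _ _ _ _ _ _ _ _ _} _ _ _.
Arguments lunit {_ _ _} _.
Arguments lunit_nat {_ _ _ _ _} _.
Arguments runit {_ _ _} _.
Arguments runit_nat {_ _ _ _ _} _.
Arguments pentagon {_ _ _ _ _ _} _ _ _ _.
Arguments triangle {_ _ _ _} _ _.

Notation "g ∘ f" := (comp g f) : bicat_scope.
Notation "β ⋆ α" := (hcomp β α) : bicat_scope.

Definition locally_preordered (S : Bicategory) : Prop :=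
  forall (X Y : S) (f g : hom X Y) (α β : f ⇒ g), α = β.

Definition is_equivalence {S : Bicategory} {X Y : S} (f : hom X Y) : Prop :=
  exists g : hom Y X, g ∘ f ≅ id1 X /\ f ∘ g ≅ id1 Y.

Definition postcomp {S : Bicategory} (T : S) {X Y : S} (m : hom X Y) :
  Functor (hom T X) (hom T Y).
Proof.
  refine {| fobj := fun w => m ∘ w; fmap := fun w w' α => idt m ⋆ α |}.
  - intro w. apply hcomp_idt.
  - intros w w' w'' β α. now rewrite <- interchange, cmp_idl.
Defined.

Definition precomp {S : Bicategory} (T : S) {X Y : S} (e : hom X Y) :
  Functor (hom Y T) (hom X T).
Proof.
  refine {| fobj := fun w => w ∘ e; fmap := fun w w' α => α ⋆ idt e |}.
  - intro w. apply hcomp_idt.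
  - intros w w' w'' β α. now rewrite <- interchange, cmp_idl.
Defined.

Definition whisker_iso {S : Bicategory} {T P C : S} {f g : hom P C}
    (θ : Iso f g) (w : hom T P) : Iso (f ∘ w) (g ∘ w).
Proof.
  refine {| fwd := fwd θ ⋆ idt w; bwd := bwd θ ⋆ idt w |}.
  - now rewrite <- interchange, bwd_fwd, cmp_idl, hcomp_idt.
  - now rewrite <- interchange, fwd_bwd, cmp_idl, hcomp_idt.
Defined.

(** [f ∘ (p ∘ w) ≅ (f ∘ p) ∘ w ≅ (g ∘ q) ∘ w ≅ g ∘ (q ∘ w)]: the component at
    [w] of the image under [hom T -] of a square [θ : f ∘ p ≅ g ∘ q]. *)

Definition hom_square_component {S : Bicategory} {P A B C : S}
    {f : hom A C} {g : hom B C} {p : hom P A} {q : hom P B}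
    (θ : Iso (f ∘ p) (g ∘ q)) {T : S} (w : hom T P) :
  Iso (f ∘ (p ∘ w)) (g ∘ (q ∘ w)) :=
  iso_trans (iso_trans (assoc f p w) (whisker_iso θ w)) (iso_sym (assoc g q w)).

Definition hom_square {S : Bicategory} {P A B C : S}
    {f : hom A C} {g : hom B C} {p : hom P A} {q : hom P B}
    (θ : Iso (f ∘ p) (g ∘ q)) (T : S) :
  NatIso (functor_comp (postcomp T f) (postcomp T p))
         (functor_comp (postcomp T g) (postcomp T q)).
Proof.
  refine (Build_NatIso _ _ (functor_comp (postcomp T f) (postcomp T p))
            (functor_comp (postcomp T g) (postcomp T q))
            (fun w => hom_square_component θ w) _).
  intros w w' α; simpl.
  assert (N : bwd (assoc g q w') · (idt (g ∘ q) ⋆ α)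
              = (idt g ⋆ (idt q ⋆ α)) · bwd (assoc g q w)).
  { rewrite <- (hcomp_idt g q).
    rewrite <- (cmp_idr _ _ _ (bwd (assoc g q w') · _)).
    rewrite <- (fwd_bwd (assoc g q w)).
    rewrite (cmp_assoc _ _ _ _ _ (bwd (assoc g q w') · _)).
    rewrite <- (cmp_assoc _ _ _ _ _ (bwd (assoc g q w'))).
    rewrite <- assoc_nat.
    now rewrite (cmp_assoc _ _ _ _ _ (bwd (assoc g q w'))), bwd_fwd, cmp_idl. }
  rewrite <- !cmp_assoc, assoc_nat, hcomp_idt.
  rewrite (cmp_assoc _ _ _ _ _ (fwd θ ⋆ idt w')).
  rewrite <- interchange, cmp_idl, cmp_idr.
  rewrite (cmp_assoc _ _ _ _ _ (idt g ⋆ (idt q ⋆ α))), <- N.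
  rewrite <- !cmp_assoc, (cmp_assoc _ _ _ _ _ (idt (g ∘ q) ⋆ α)).
  now rewrite <- interchange, cmp_idl, cmp_idr.
Defined.

Definition is_bipullback {S : Bicategory} {P A B C : S}
    {f : hom A C} {g : hom B C} {p : hom P A} {q : hom P B}
    (θ : Iso (f ∘ p) (g ∘ q)) : Prop :=
  forall T : S, is_bipullback_cat (hom_square θ T).

Definition bipullback_square {S : Bicategory} {P A B C : S}
    (f : hom A C) (g : hom B C) (p : hom P A) (q : hom P B) : Prop :=
  exists θ : Iso (f ∘ p) (g ∘ q), is_bipullback θ.

Definition morphism_class (S : Bicategory) : Type :=
  forall X Y : S, hom X Y -> Prop.

Definition in_class {S : Bicategory} {X Y : S} (f : hom X Y)
    (K : morphism_class S) : Prop := K X Y f.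

Notation "f ∈ K" := (in_class f K) : bicat_scope.

(** The square with vertices [hom Y A], [hom X A], [hom Y B], [hom X B], filled
    by the associators [m ∘ (w ∘ e) ≅ (m ∘ w) ∘ e]. *)

Definition orthogonality_square {S : Bicategory} {X Y A B : S}
    (e : hom X Y) (m : hom A B) :
  NatIso (functor_comp (postcomp X m) (precomp A e))
         (functor_comp (precomp B e) (postcomp Y m)).
Proof.
  refine (Build_NatIso _ _ (functor_comp (postcomp X m) (precomp A e))
            (functor_comp (precomp B e) (postcomp Y m))
            (fun w => assoc m w e) _).
  intros w w' α; simpl. apply assoc_nat.
Defined.

Record admissible_class {S : Bicategory} (K : morphism_class S) : Prop := {
  class_equivalence : forall (X Y : S) (f : hom X Y), is_equivalence f -> f ∈ K;
  class_comp : forall (X Y Z : S) (g : hom Y Z) (f : hom X Y),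
    g ∈ K -> f ∈ K -> g ∘ f ∈ K;
  class_iso : forall (X Y : S) (f g : hom X Y), f ≅ g -> f ∈ K -> g ∈ K
}.

Record factorization_system {S : Bicategory} (cU cL : morphism_class S) :
    Prop := {
  FS_U : admissible_class cU;
  FS_L : admissible_class cL;
  FS1 : forall (X Y A B : S) (e : hom X Y) (m : hom A B),
    e ∈ cU -> m ∈ cL -> is_bipullback_cat (orthogonality_square e m);
  FS2 : forall (X Y : S) (f : hom X Y),
    exists (I : S) (e : hom X I) (m : hom I Y),
      e ∈ cU /\ m ∈ cL /\ f ≅ m ∘ e
}.

Definition bipullback_stable {S : Bicategory} (K : morphism_class S) : Prop :=
  forall (A B C : S) (f : hom A C) (g : hom B C), f ∈ K -> g ∈ K ->
    (exists (P : S) (p : hom P A) (q : hom P B), bipullback_square f g p q) /\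
    (forall (P : S) (p : hom P A) (q : hom P B),
       bipullback_square f g p q -> p ∈ K /\ q ∈ K).

Definition span_iso {S : Bicategory} {X Y P P' : S}
    (p : hom P X) (q : hom P Y) (p' : hom P' X) (q' : hom P' Y) : Prop :=
  exists h : hom P P', is_equivalence h /\ p' ∘ h ≅ p /\ q' ∘ h ≅ q.

(** [a ∈ cU], [x ∈ cL] is the given cospan, [b ∈ cU], [y ∈ cL] the completion. *)

Definition V2_square {S : Bicategory} (cU cL : morphism_class S)
    {X Y Z U : S} (a : hom X Z) (x : hom Y Z) (b : hom U Y) (y : hom U X) :
    Prop :=
  b ∈ cU /\ y ∈ cL /\ inhabited (x ∘ b ⇒ a ∘ y).

Record fake_pullback_ready (S : Bicategory) (cU cL : morphism_class S) :
    Prop := {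
  FPR_preordered : locally_preordered S;
  FPR_factorization : factorization_system cU cL;
  V1_U : bipullback_stable cU;
  V1_L : bipullback_stable cL;
  V2_existence : forall (X Y Z : S) (a : hom X Z) (x : hom Y Z),
    a ∈ cU -> x ∈ cL ->
    exists (U : S) (b : hom U Y) (y : hom U X), V2_square cU cL a x b y;
  V2_uniqueness : forall (X Y Z : S) (a : hom X Z) (x : hom Y Z),
    a ∈ cU -> x ∈ cL ->
    forall (U : S) (b : hom U Y) (y : hom U X)
           (U' : S) (b' : hom U' Y) (y' : hom U' X),
    V2_square cU cL a x b y -> V2_square cU cL a x b' y' ->
    span_iso b y b' y';
  V3 : forall (X Y A B Z C I J : S)
      (x : hom X Y) (y : hom A B) (r : hom X A) (s : hom Y B) (t : hom Z C)
      (a : hom Y Z) (b : hom B C)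
      (c : hom X I) (v : hom I Z) (d : hom A J) (w : hom J C),
    x ∈ cL -> y ∈ cL -> r ∈ cL -> s ∈ cL -> t ∈ cL -> a ∈ cU -> b ∈ cU ->
    bipullback_square s y x r ->
    inhabited (t ∘ a ⇒ b ∘ s) ->
    c ∈ cU -> v ∈ cL -> a ∘ x ≅ v ∘ c ->
    d ∈ cU -> w ∈ cL -> b ∘ y ≅ w ∘ d ->
    exists q : hom I J,
      q ∈ cL /\ inhabited (q ∘ c ⇒ d ∘ r) /\ bipullback_square t w v q;
  V4 : forall (X Y D E F Z K I : S)
      (x : hom X Y) (u : hom D E)
      (h : hom E F) (a : hom Y Z) (e : hom D X) (f : hom E Y) (g : hom F Z)
      (k : hom D K) (p : hom K F) (c : hom X I) (v : hom I Z),
    x ∈ cL -> u ∈ cL -> h ∈ cU -> a ∈ cU -> e ∈ cU -> f ∈ cU -> g ∈ cU ->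
    inhabited (x ∘ e ⇒ f ∘ u) ->
    bipullback_square g a h f ->
    k ∈ cU -> p ∈ cL -> h ∘ u ≅ p ∘ k ->
    c ∈ cU -> v ∈ cL -> a ∘ x ≅ v ∘ c ->
    exists j : hom K I,
      j ∈ cU /\ bipullback_square j c k e /\ inhabited (v ∘ j ⇒ g ∘ p)
}.

Arguments fake_pullback_ready {_} _ _.

(** All the choices made in the construction: factorizations [r ≅ x ∘ a] and
    [s ≅ y ∘ b], the bipullback [Z] of the [cL]-parts, the V2-completions
    [X] and [Y], and the bipullback [Q] of their [cU]-parts. *)

Record fake_pullback_construction {S : Bicategory} (cU cL : morphism_class S)
    {U V W : S} (r : hom U W) (s : hom V W) : Type := {
  fp_R : S; fp_S : S; fp_Z : S; fp_X : S; fp_Y : S; fp_Q : S;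
  fp_a : hom U fp_R;  fp_a_U : fp_a ∈ cU;
  fp_x : hom fp_R W;  fp_x_L : fp_x ∈ cL;
  fp_r_factor : r ≅ fp_x ∘ fp_a;
  fp_b : hom V fp_S;  fp_b_U : fp_b ∈ cU;
  fp_y : hom fp_S W;  fp_y_L : fp_y ∈ cL;
  fp_s_factor : s ≅ fp_y ∘ fp_b;
  fp_y' : hom fp_Z fp_R;
  fp_x' : hom fp_Z fp_S;
  fp_Z_bipullback : bipullback_square fp_x fp_y fp_y' fp_x';
  fp_abar : hom fp_X fp_Z;
  fp_ybar : hom fp_X U;
  fp_X_square : V2_square cU cL fp_a fp_y' fp_abar fp_ybar;
  fp_bbar : hom fp_Y fp_Z;
  fp_xbar : hom fp_Y V;
  fp_Y_square : V2_square cU cL fp_b fp_x' fp_bbar fp_xbar;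
  fp_b' : hom fp_Q fp_X;
  fp_a' : hom fp_Q fp_Y;
  fp_Q_bipullback : bipullback_square fp_abar fp_bbar fp_b' fp_a'
}.

Arguments fp_Q {_ _ _ _ _ _ _ _} _.
Arguments fp_ybar {_ _ _ _ _ _ _ _} _.
Arguments fp_xbar {_ _ _ _ _ _ _ _} _.
Arguments fp_b' {_ _ _ _ _ _ _ _} _.
Arguments fp_a' {_ _ _ _ _ _ _ _} _.

Definition is_fake_pullback {S : Bicategory} (cU cL : morphism_class S)
    {U V W Q : S} (r : hom U W) (s : hom V W) (p : hom Q U) (q : hom Q V) :
    Prop :=
  exists c : fake_pullback_construction cU cL r s,
    span_iso p q (fp_ybar c ∘ fp_b' c) (fp_xbar c ∘ fp_a' c).

(* Main.v *)
(** Write the two constructions over the factorizations [r ≅ x ∘ a] and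
    [t ≅ t2 ∘ t1].  The composite [ybar ∘ b'] is itself a factorization of
    [sbar], so by uniqueness of factorizations it may be replaced by the one
    that the second construction uses.  Factorize [a ∘ t2 ≅ v ∘ c]; then [(x ∘ v) ∘ (c ∘ t1)]
    factorizes [r ∘ t].  V3 provides the bipullback of [v] along [y'], V4
    provides the bipullback of [cU]-morphisms missing from the last step, and
    pasting bipullbacks assembles a construction for [r ∘ t] on the same
    object [P]. *)

Require Import Defs.
From Stdlib Require Import Setoid Morphisms.

(** Named versions of [inhabited (Iso f g)] and [inhabited (f ⇒ g)], to which
    generalized rewriting applies. *)
Definition iso_rel {C : Category} (f g : C) : Prop := f ≅ g.
Definition le_rel {C : Category} (f g : C) : Prop := inhabited (f ⇒ g).

Notation "f ~ g" := (iso_rel f g) (at level 70, no associativity).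
Notation "f ≲ g" := (le_rel f g) (at level 70, no associativity).

Global Instance iso_rel_equivalence (C : Category) :
  Equivalence (@iso_rel C).
Proof.
  split.
  - intro f. constructor.
    exists (idt f) (idt f); apply cmp_idl.
  - intros f g [φ]. exact (inhabits (iso_sym φ)).
  - intros f g h [φ] [ψ]. exact (inhabits (iso_trans φ ψ)).
Qed.

Global Instance le_rel_preorder (C : Category) : PreOrder (@le_rel C).
Proof.
  split.
  - intro f. exact (inhabits (idt f)).
  - intros f g h [φ] [ψ]. exact (inhabits (ψ · φ)).
Qed.

Global Instance le_rel_iso_proper (C : Category) :
  Proper (iso_rel ==> iso_rel ==> iff) (@le_rel C).
Proof.
  intros f f' [φ] g g' [ψ]. split; intros [α]; constructor.
  - exact (ψ · α · bwd φ).
  - exact (bwd ψ · α · φ).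
Qed.

Global Instance comp_iso_proper (S : Bicategory) (X Y Z : S) :
  Proper (iso_rel ==> iso_rel ==> iso_rel) (@comp S X Y Z).
Proof.
  intros g g' [ψ] f f' [φ]. constructor.
  exists (ψ ⋆ φ) (bwd ψ ⋆ bwd φ).
  - now rewrite <- interchange, !bwd_fwd, hcomp_idt.
  - now rewrite <- interchange, !fwd_bwd, hcomp_idt.
Qed.

Global Instance comp_le_proper (S : Bicategory) (X Y Z : S) :
  Proper (le_rel ==> le_rel ==> le_rel) (@comp S X Y Z).
Proof. intros g g' [ψ] f f' [φ]. exact (inhabits (ψ ⋆ φ)). Qed.

Lemma compA {S : Bicategory} {X Y Z T : S}
    (h : hom Z T) (g : hom Y Z) (f : hom X Y) : h ∘ (g ∘ f) ~ (h ∘ g) ∘ f.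
Proof. exact (inhabits (assoc h g f)). Qed.

Lemma comp1l {S : Bicategory} {X Y : S} (f : hom X Y) : id1 Y ∘ f ~ f.
Proof. exact (inhabits (lunit f)). Qed.

Lemma comp1r {S : Bicategory} {X Y : S} (f : hom X Y) : f ∘ id1 X ~ f.
Proof. exact (inhabits (runit f)). Qed.

Lemma le_antisym {S : Bicategory} (HP : locally_preordered S) {X Y : S}
    (f g : hom X Y) : f ≲ g -> g ≲ f -> f ~ g.
Proof. intros [α] [β]. constructor. exists α β; apply HP. Qed.

(** Equations between 2-cells hold automatically here, so essential surjectivity of the comparison
    functor reduces to existence of a mediating 1-cell, and full faithfulness to joint reflection of
    the order by the two projections. *)
Lemma bipullback_squareP {S : Bicategory} (HP : locally_preordered S)
    {P A B C : S} (f : hom A C) (g : hom B C) (p : hom P A) (q : hom P B) :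
  bipullback_square f g p q <->
  f ∘ p ~ g ∘ q /\
  (forall (T : S) (a : hom T A) (b : hom T B), f ∘ a ~ g ∘ b ->
     exists z : hom T P, p ∘ z ~ a /\ q ∘ z ~ b) /\
  (forall (T : S) (z z' : hom T P),
     p ∘ z ≲ p ∘ z' -> q ∘ z ≲ q ∘ z' -> z ≲ z').
Proof.
  split.
  - intros [θ Hθ]. split; [exact (inhabits θ) | split]; intro T.
    + intros a b [φ]. destruct (proj1 (Hθ T) a b φ) as (z & α & β & _).
      exists z. split; [exact (inhabits α) | exact (inhabits β)].
    + intros z z' [α] [β].
      destruct (proj2 (Hθ T) z z' α β) as [γ _]; [apply HP |].
      exact (inhabits γ).
  - intros ([θ] & Hex & Hle). exists θ. intro T. split.
    + intros a b φ. destruct (Hex T a b (inhabits φ)) as (z & [α] & [β]).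
      exists z, α, β. apply HP.
    + intros z z' α β _. destruct (Hle T z z' (inhabits α) (inhabits β)) as [γ].
      exists γ. split; [split |]; intros; apply HP.
Qed.

Lemma bipullback_swap {S : Bicategory} (HP : locally_preordered S)
    {P A B C : S} (f : hom A C) (g : hom B C) (p : hom P A) (q : hom P B) :
  bipullback_square f g p q -> bipullback_square g f q p.
Proof.
  rewrite !bipullback_squareP by assumption. intros (H & Hex & Hle).
  split; [now symmetry | split].
  - intros T a b E. symmetry in E. destruct (Hex T b a E) as (z & ? & ?).
    now exists z.
  - intros T z z' ? ?. now apply Hle.
Qed.

Lemma bipullback_paste {S : Bicategory} (HP : locally_preordered S)
    {P Q A A' B C : S} (f : hom A C) (g : hom B C) (p : hom P A) (q : hom P B)
    (f' : hom A' A) (p' : hom Q A') (q' : hom Q P) :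
  bipullback_square f g p q -> bipullback_square f' p p' q' ->
  bipullback_square (f ∘ f') g p' (q ∘ q').
Proof.
  rewrite !bipullback_squareP by assumption.
  intros (H & Hex & Hle) (H' & Hex' & Hle'). split; [| split].
  - now rewrite <- compA, H', !compA, H.
  - intros T a b E. rewrite <- compA in E.
    destruct (Hex T _ _ E) as (z & Ha & Hb). symmetry in Ha.
    destruct (Hex' T _ _ Ha) as (w & Hw & Hz).
    exists w. split; [exact Hw |]. now rewrite <- compA, Hz.
  - intros T z z' Hp Hq. rewrite <- !compA in Hq.
    (* The outer legs end in [A'] and [B]; the comparison in [A] that [Hle] also needs is [Hp]
       whiskered with [f'] and carried across the square [H']. *)
    apply Hle'; [exact Hp |]. apply Hle; [| exact Hq].
    now rewrite !compA, <- H', <- !compA, Hp.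
Qed.

(** The corner [A] and the apex [P] are exchanged for equivalent objects. The leg [p'] is fixed only
    up to an invertible 2-cell, so it can be the [cU]-part of another chosen factorization. *)
Lemma bipullback_transport {S : Bicategory} (HP : locally_preordered S)
    {P P' A A' B C : S} (f : hom A C) (g : hom B C) (p : hom P A) (q : hom P B)
    (e : hom A A') (e' : hom A' A) (h : hom P' P)
    (p' : hom P' A') :
  e' ∘ e ~ id1 A -> e ∘ e' ~ id1 A' -> is_equivalence h ->
  p' ~ e ∘ (p ∘ h) ->
  bipullback_square f g p q -> bipullback_square (f ∘ e') g p' (q ∘ h).
Proof.
  rewrite !bipullback_squareP by assumption.
  intros He'e Hee' (k & Hkh & Hhk) Hp' (H & Hex & Hle).
  change (k ∘ h ~ id1 P') in Hkh. change (h ∘ k ~ id1 P) in Hhk.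
  assert (Hp : e' ∘ p' ~ p ∘ h) by now rewrite Hp', compA, He'e, comp1l.
  split; [| split].
  - now rewrite <- compA, Hp, !compA, H.
  - intros T a b E. rewrite <- compA in E.
    destruct (Hex T _ _ E) as (z & Ha & Hb).
    exists (k ∘ z). split.
    + rewrite Hp', <- !compA, (compA h k), Hhk, comp1l, Ha, compA, Hee'.
      apply comp1l.
    + now rewrite <- compA, (compA h k), Hhk, comp1l.
  - intros T z z' Hz Hq. rewrite <- !compA in Hq.
    assert (L : h ∘ z ≲ h ∘ z').
    { apply Hle; [| exact Hq]. now rewrite !compA, <- Hp, <- !compA, Hz. }
    now rewrite <- (comp1l z), <- (comp1l z'), <- Hkh, <- !compA, L.
Qed.

(** Diagonal fillers come from the essential surjectivity half of [FS1]; the full faithfulness half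
    gives [orthogonality_le]. *)
Lemma orthogonality {S : Bicategory} {cU cL : morphism_class S}
    (HF : factorization_system cU cL) {X Y A B : S}
    (e : hom X Y) (m : hom A B) (u : hom X A) (v : hom Y B) :
  e ∈ cU -> m ∈ cL -> m ∘ u ~ v ∘ e ->
  exists w : hom Y A, w ∘ e ~ u /\ m ∘ w ~ v.
Proof.
  intros He Hm [φ].
  destruct (proj1 (FS1 _ _ HF _ _ _ _ e m He Hm) u v φ) as (w & α & β & _).
  exists w. split; [exact (inhabits α) | exact (inhabits β)].
Qed.

Lemma orthogonality_le {S : Bicategory} (HP : locally_preordered S)
    {cU cL : morphism_class S} (HF : factorization_system cU cL) {X Y A B : S}
    (e : hom X Y) (m : hom A B) (w w' : hom Y A) :
  e ∈ cU -> m ∈ cL -> w ∘ e ≲ w' ∘ e -> m ∘ w ≲ m ∘ w' -> w ≲ w'.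
Proof.
  intros He Hm [α] [β].
  destruct (proj2 (FS1 _ _ HF _ _ _ _ e m He Hm) w w' α β) as [γ _];
    [apply HP | exact (inhabits γ)].
Qed.

Lemma factorization_endo {S : Bicategory} (HP : locally_preordered S)
    {cU cL : morphism_class S} (HF : factorization_system cU cL) {X I Y : S}
    (e : hom X I) (m : hom I Y) (w : hom I I) :
  e ∈ cU -> m ∈ cL -> w ∘ e ~ e -> m ∘ w ~ m -> w ~ id1 I.
Proof.
  intros He Hm H1 H2.
  apply (le_antisym HP); apply (orthogonality_le HP HF e m); trivial;
    now rewrite ?H1, ?H2, ?comp1l, ?comp1r.
Qed.

(** Diagonal fillers in both directions give [w] and [w']. Their composites fix both parts of a
    factorization, hence are identities by [factorization_endo]. *)
Lemma factorization_unique {S : Bicategory} (HP : locally_preordered S)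
    {cU cL : morphism_class S} (HF : factorization_system cU cL) {X Y I J : S}
    (e : hom X I) (m : hom I Y) (d : hom X J) (n : hom J Y) :
  e ∈ cU -> m ∈ cL -> d ∈ cU -> n ∈ cL -> m ∘ e ~ n ∘ d ->
  exists (w : hom I J) (w' : hom J I),
    w' ∘ w ~ id1 I /\ w ∘ w' ~ id1 J /\ w ∘ e ~ d /\ n ∘ w ~ m.
Proof.
  intros He Hm Hd Hn E.
  destruct (orthogonality HF d m e n Hd Hm E) as (w' & H1' & H2').
  symmetry in E.
  destruct (orthogonality HF e n d m He Hn E) as (w & H1 & H2).
  exists w, w'. split; [| split; [| now split]].
  - apply (factorization_endo HP HF e m); trivial.
    + now rewrite <- compA, H1.
    + now rewrite compA, H2'.
  - apply (factorization_endo HP HF d n); trivial.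
    + now rewrite <- compA, H1'.
    + now rewrite compA, H2.
Qed.

Lemma equivalence_of {S : Bicategory} {X Y : S} (f : hom X Y) (g : hom Y X) :
  g ∘ f ~ id1 X -> f ∘ g ~ id1 Y -> is_equivalence f.
Proof. intros. now exists g. Qed.

Theorem proposition12 (S : Bicategory) (cU cL : morphism_class S)
    (HS : fake_pullback_ready cU cL)
    (X U W V Q P : S)
    (t : hom X U) (r : hom U W) (s : hom V W)
    (sbar : hom Q U) (rbar : hom Q V)
    (sbarbar : hom P X) (tbar : hom P Q) :
  is_fake_pullback cU cL r s sbar rbar ->
  is_fake_pullback cU cL t sbar sbarbar tbar ->
  is_fake_pullback cU cL (r ∘ t) s sbarbar (rbar ∘ tbar).
Proof.
  pose proof (FPR_preordered _ _ _ HS) as HP.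
  pose proof (FPR_factorization _ _ _ HS) as HF.
  pose proof (FS_U _ _ HF) as AU. pose proof (FS_L _ _ HF) as AL.
  intros [[R S1 Z M0 N Q0 a aU x xL rE b bU y yL sE y' x' Zbp abar0 ybar0
             [abar0U [ybar0L X2]] bbar xbar [bbarU [xbarL Y2]] b'0 a'0 Qbp0]
          (h & Hh & E1 & E2)].
  intros [[T M Z2 M2 N2 P0 t1 t1U t2 t2L tE b' b'U ybar ybarL sbarE y2 t2'
             Z2bp t1bar y2bar [t1barU [y2barL X2']] b2 t2bar
             [b2U [t2barL Y2']] b2' t1' Pbp]
          (h' & Hh' & E1' & E2')].
  simpl in *.
  change (ybar0 ∘ b'0 ∘ h ~ sbar) in E1. change (xbar ∘ a'0 ∘ h ~ rbar) in E2.
  change (y2bar ∘ b2' ∘ h' ~ sbarbar) in E1'.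
  change (t2bar ∘ t1' ∘ h' ~ tbar) in E2'.
  change (r ~ x ∘ a) in rE. change (s ~ y ∘ b) in sE. change (t ~ t2 ∘ t1) in tE.
  change (sbar ~ ybar ∘ b') in sbarE.
  change (y' ∘ abar0 ≲ a ∘ ybar0) in X2. change (x' ∘ bbar ≲ b ∘ xbar) in Y2.
  change (y2 ∘ t1bar ≲ t1 ∘ y2bar) in X2'. change (t2' ∘ b2 ≲ b' ∘ t2bar) in Y2'.
  pose proof (V1_U _ _ _ HS _ _ _ _ _ abar0U bbarU) as [_ Q0U].
  destruct (Q0U _ _ _ Qbp0) as [b'0U a'0U].
  (* Both pairs factorize [sbar]: the first through [E1], with [b'0] in [cU] as a projection of a
     bipullback in [cU], the second through [sbarE]. *)
  destruct (factorization_unique HP HF (b'0 ∘ h) ybar0 b' ybar)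
    as (e & e' & e'e & ee' & eb & ye); trivial.
  { apply (class_comp _ AU); trivial. now apply (class_equivalence _ AU). }
  { now rewrite compA, E1. }
  (* The first construction, moved along the equivalence [e] of factorizations. *)
  set (abar := abar0 ∘ e'). set (a' := a'0 ∘ h).
  assert (abarU : abar ∈ cU).
  { apply (class_comp _ AU); trivial. apply (class_equivalence _ AU).
    now apply (equivalence_of e' e). }
  assert (a'U : a' ∈ cU).
  { apply (class_comp _ AU); trivial. now apply (class_equivalence _ AU). }
  assert (Xsq : y' ∘ abar ≲ a ∘ ybar).
  { unfold abar. rewrite compA, X2, <- ye, <- compA, <- (compA _ e), ee', comp1r.
    reflexivity. }
  assert (Qbp : bipullback_square abar bbar b' a').
  { apply (bipullback_transport HP abar0 bbar b'0 a'0 e e' h b'); trivial.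
    now symmetry. }
  (* From here on [abar] enters only through [abarU], [Xsq] and [Qbp]; [a'] stays transparent, since
     [E2] is stated with [a'0 ∘ h]. *)
  clearbody abar.
  pose proof (V1_L _ _ _ HS _ _ _ _ _ xL yL) as [_ ZL].
  destruct (ZL _ _ _ Zbp) as [y'L x'L].
  pose proof (V1_L _ _ _ HS _ _ _ _ _ t2L ybarL) as [_ Z2L].
  destruct (Z2L _ _ _ Z2bp) as [y2L t2'L].
  destruct (FS2 _ _ HF _ _ (a ∘ t2)) as (I & c & v & cU' & vL & cvE).
  destruct (FS2 _ _ HF _ _ (abar ∘ t2')) as (J & d & w & dU & wL & dwE).
  destruct (FS2 _ _ HF _ _ (a' ∘ t2bar)) as (K & k & p & kU & pL & kpE).
  (* V3 pushes the bipullback [Z2] forward along [abar] and [a], giving [J] as the bipullback of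
     [y'] and [v]. The factorization [w ∘ d] of [abar ∘ t2'] is reused in V4, which makes the two
     outputs fit together. *)
  destruct (V3 _ _ _ HS _ _ _ _ _ _ _ _ t2' t2 y2 ybar y' abar a d w c v)
    as (q & qL & qd & Jbp); trivial.
  { now apply bipullback_swap. }
  destruct (V4 _ _ _ HS _ _ _ _ _ _ _ _ t2' t2bar a' abar b2 b' bbar k p d w)
    as (j & jU & N2bp & wj); trivial.
  { now apply bipullback_swap. }
  change (a ∘ t2 ~ v ∘ c) in cvE. change (a' ∘ t2bar ~ p ∘ k) in kpE.
  change (q ∘ d ≲ c ∘ y2) in qd. change (w ∘ j ≲ bbar ∘ p) in wj.
  unshelve eexists.
  (* The implicit objects [fp_R] to [fp_Q] become [I], [S1], [J], [M2], [K] and [P0], so the apex is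
     that of the second construction. *)
  - refine {| fp_a := c ∘ t1; fp_x := x ∘ v; fp_b := b; fp_y := y;
              fp_y' := q; fp_x' := x' ∘ w; fp_abar := d ∘ t1bar;
              fp_ybar := y2bar; fp_bbar := j; fp_xbar := xbar ∘ p;
              fp_b' := b2'; fp_a' := k ∘ t1' |}; trivial.
    + now apply (class_comp _ AU).
    + now apply (class_comp _ AL).
    + change (r ∘ t ~ x ∘ v ∘ (c ∘ t1)).
      now rewrite rE, tE, <- !compA, (compA a), cvE, <- !compA.
    + apply (bipullback_paste HP x y y' x'); trivial. now apply bipullback_swap.
    + split; [| split]; trivial; [now apply (class_comp _ AU) |].
      change (q ∘ (d ∘ t1bar) ≲ c ∘ t1 ∘ y2bar).
      (* The 2-cell from V3 is pasted with the V2-square of the second construction. *)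
      now rewrite compA, qd, <- !compA, X2'.
    + split; [| split]; trivial; [now apply (class_comp _ AL) |].
      change (x' ∘ w ∘ j ≲ b ∘ (xbar ∘ p)).
      now rewrite <- compA, wj, !compA, Y2.
    + apply (bipullback_paste HP d j b2 k); trivial. now apply bipullback_swap.
  (* With the apex and the leg to [X] unchanged, [h'] still serves; the leg to [V] agrees because
     [a' ∘ t2bar] factorizes as [p ∘ k]. *)
  - exists h'. split; [exact Hh' | split; [exact E1' |]]. simpl.
    change (xbar ∘ p ∘ (k ∘ t1') ∘ h' ~ rbar ∘ tbar).
    rewrite <- E2, <- E2', <- !compA, (compA p), <- kpE.
    unfold a'. now rewrite <- !compA.
Qed.
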